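(* For a complete Boolean algebra $\mathbb{B}$ the following conditions are equivalent: (a) White has a winning strategy in the game $\mathcal{G}_3$ on $\mathbb{B}$; (b) There are $p\in\mathbb{B}^+$ and $w:{}^{<\omega}2\to(0,p)_{\mathbb{B}}$ such that $$\forall i:\omega\to 2\quad \bigvee_{A\in[\omega]^{\omega}}\ \bigwedge_{n\in A}w_{i\upharpoonright n}^{i(n)}=0;$$ (c) There are $p\in\mathbb{B}^+$ and $w:{}^{<\omega}2\to[0,p]_{\mathbb{B}}$ such that $$\forall i:\omega\to 2\quad \bigvee_{A\in[\omega]^{\omega}}\ \bigwedge_{n\in A}w_{i\upharpoonright n}^{i(n)}=0;$$ (d) There are $p\in\mathbb{B}^+$ and a $\mathbb{B}$-name $\rho\in V^{\mathbb{B}}$ such that $p$ forces the conjunction of: $\rho\subseteq({}^{<\omega}2)\check{\ }$; for every $\varphi\in({}^{<\omega}2)\check{\ }$, exactly one of $\varphi^{\frown}0$, $\varphi^{\frown}1$ belongs to $\rho$; and for every $i\in(({}^{\omega}2)^V)\check{\ }$, the set $\rho\cap g^i$ is unsupported; (e) In some generic extension $V_{\mathbb{B}}[G]$ of $V$ by $\mathbb{B}$, there is a subset $R$ of the tree ${}^{<\omega}2$ containing exactly one of $\varphi^{\frown}0$, $\varphi^{\frown}1$ for each $\varphi\in{}^{<\omega}2$, and having unsupported intersection with each branch $g^i$ ($i\in{}^{\omega}2\cap V$) of the tree ${}^{<\omega}2$ belonging to $V$.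
   Context: Let $\mathbb{B}$ be a complete Boolean algebra in the ground model $V$, $\mathbb{B}^+=\mathbb{B}\setminus\{0\}$; for $p\in\mathbb{B}^+$ let $(0,p)_{\mathbb{B}}=\{b\in\mathbb{B}:0<b<p\}$ and $[0,p]_{\mathbb{B}}=\{b\in\mathbb{B}:0\le b\le p\}$. For $b\le p$ put $b^0=b$ and $b^1=p\setminus b$. The game $\mathcal{G}_3$ is played by two players, White and Black, on $\mathbb{B}$ in $\omega$-many moves. At the beginning White chooses $p\in\mathbb{B}^+$. In the $n$-th move ($n\in\omega$) White chooses $p_n\in(0,p)_{\mathbb{B}}$ and Black responds by choosing $i_n\in\{0,1\}$. White wins the play $\langle p,p_0,i_0,p_1,i_1,\dots\rangle$ in $\mathcal{G}_3$ iff $\bigvee_{A\in[\omega]^{\omega}}\bigwedge_{n\in A}p_n^{i_n}=0$, where $[\omega]^\omega$ is the set of infinite subsets of $\omega$; otherwise Black wins. A winning strategy for White is a function which, on the basis of the previous moves of both players, provides moves (obeying the rules) for White such that White always wins. ${}^{<\omega}2$ is the set of finite $0$-$1$ sequences; $\varphi^{\frown}k$ is $\varphi$ extended by the value $k$; $w_\varphi$ denotes $w(\varphi)$; for $i:\omega\to2$, $g^i=\{i\upharpoonright n:n\in\omega\}$ is the corresponding branch of the tree ${}^{<\omega}2$. $V^{\mathbb{B}}$ is the class of $\mathbb{B}$-names and $\check{x}$ is the canonical name of $x\in V$. A set in a generic extension that is a subset of $\omega$ (or of the countable ground-model set ${}^{<\omega}2$) is called supported iff it contains an infinite subset belonging to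 the ground model $V$, and unsupported otherwise; in particular finite sets are unsupported. *)

(* Defs.v *)
(* A Boolean algebra is a ctbDistrLatticeType: a bounded distributive lattice
   with relative complements and a complement. *)
From mathcomp Require Import all_boot all_order.
From mathcomp Require Import boolp classical_sets functions cardinality.

Set Implicit Arguments.
Unset Strict Implicit.
Unset Printing Implicit Defensive.

Import Order.TTheory.
Local Open Scope order_scope.

Definition complete_boolean d (B : ctbDistrLatticeType d) : Prop :=
  forall S : set B, exists b, supremums S b.

(* Join and meet of the family (f i)_{i | P i}. Only the set of its values is
   an instance of [set]: the index type may be the proper class of names, whose
   universe is larger than those at which [set], [image], ... can be used. *)
Definition bjoin d (B : ctbDistrLatticeType d) (I : Type) (P : I -> Prop)
    (f : I -> B) : B :=
  supremum \bot (fun b : B => exists2 i : I, P i & b = f i).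

Definition bmeet d (B : ctbDistrLatticeType d) (I : Type) (P : I -> Prop)
    (f : I -> B) : B :=
  infimum \top (fun b : B => exists2 i : I, P i & b = f i).

(* b^0 = b and b^1 = p \ b, the digits 0, 1 being false, true. *)
Definition bpow d (B : ctbDistrLatticeType d) (p b : B) (k : bool) : B :=
  if k then p `\` b else b.

(* The element \/_{A in [omega]^omega} /\_{n in A} (q n)^(i n), in [0, p]. *)
Definition inf_often d (B : ctbDistrLatticeType d) (p : B)
    (q : nat -> B) (i : nat -> bool) : B :=
  bjoin (fun A : set nat => infinite_set A)
    (fun A => bmeet (fun n => A n) (fun n => bpow p (q n) (i n))).

(* A strategy for White: the opening p, and the reply to the sequence
   (p_0, i_0), ..., (p_{n-1}, i_{n-1}) of the moves played after the opening. *)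
Record white_strategy d (B : ctbDistrLatticeType d) := WhiteStrategy {
  opening : B;
  reply : seq (B * bool) -> B
}.

Definition follows d (B : ctbDistrLatticeType d) (s : white_strategy B)
    (q : nat -> B) (i : nat -> bool) : Prop :=
  forall n, q n = reply s (mkseq (fun k => (q k, i k)) n).

Definition legal_white d (B : ctbDistrLatticeType d) (p : B) (q : nat -> B)
    : Prop :=
  \bot < p /\ forall n, \bot < q n < p.

Definition white_wins d (B : ctbDistrLatticeType d) (p : B) (q : nat -> B)
    (i : nat -> bool) : Prop :=
  inf_often p q i = \bot.

Definition winning_G3 d (B : ctbDistrLatticeType d) (s : white_strategy B)
    : Prop :=
  forall q i, follows s q i ->
    legal_white (opening s) q /\ white_wins (opening s) q i.

(* The ground model V is the universe of types, in the form of Aczel's trees: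
   VSet x is the set {x j : j}, and sets are compared extensionally. *)
Inductive vset : Type := VSet (I : Type) (x : I -> vset).

Definition vupair (x y : vset) : vset :=
  VSet (fun b : bool => if b then x else y).

Definition vopair (x y : vset) : vset := vupair (vupair x x) (vupair x y).

Definition vsucc (x : vset) : vset :=
  let: VSet T f := x in
  VSet (fun o : option T => if o is Some j then f j else x).

Fixpoint vnat (n : nat) : vset :=
  if n is m.+1 then vsucc (vnat m)
  else VSet (fun e : Empty_set => match e with end).

Definition vomega : vset := VSet vnat.

Definition vseq (s : seq bool) : vset :=
  VSet (fun k : 'I_(size s) => vopair (vnat k) (vnat (nth false s k))).

Definition vreal (i : nat -> bool) : vset :=
  VSet (fun n : nat => vopair (vnat n) (vnat (i n))).

(* The following code, with 0-1 sequences as sets of ordered pairs, the sets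
   ^{<omega}2, (^omega 2)^V and that of all infinite subsets of ^{<omega}2
   that belong to V. *)
Definition vtree : vset := VSet vseq.

Definition vcantor : vset := VSet vreal.

Definition vsubset (A : set (seq bool)) : vset :=
  VSet (fun s : {s : seq bool | A s} => vseq (sval s)).

Definition vinfsets : vset :=
  VSet (fun A : {A : set (seq bool) | infinite_set A} => vsubset (sval A)).

(* B-names: the name [BName x b] consists of the pairs (x j, b j), j : I. *)
Inductive bname d (B : ctbDistrLatticeType d) : Type :=
  BName (I : Type) (x : I -> bname B) (b : I -> B).

Fixpoint check d (B : ctbDistrLatticeType d) (v : vset) : bname B :=
  let: VSet T x := v in BName (fun j : T => check B (x j)) (fun _ => \top).

Definition bimp d (B : ctbDistrLatticeType d) (a b : B) : B := ~` a `|` b.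

(* Boolean values [[x = y]] and [[x \in y]]; the occurrences of [[u \in y]] and
   [[v \in x]] in the usual clause for [[x = y]] are unfolded. *)
Fixpoint beq d (B : ctbDistrLatticeType d) (x : bname B) : bname B -> B :=
  let: BName T1 u b := x in
  fun y =>
    let: BName T2 v c := y in
    bmeet (fun _ : T1 => True) (fun j =>
      bimp (b j) (bjoin (fun _ : T2 => True) (fun k => c k `&` beq (u j) (v k))))
    `&`
    bmeet (fun _ : T2 => True) (fun k =>
      bimp (c k) (bjoin (fun _ : T1 => True) (fun j => b j `&` beq (u j) (v k)))).

Definition bmem d (B : ctbDistrLatticeType d) (x y : bname B) : B :=
  let: BName T v c := y in
  bjoin (fun _ : T => True) (fun k => c k `&` beq x (v k)).

(* Formulas of set theory with parameters in X, in higher-order abstract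
   syntax. Those defined below are uniform in X, hence first-order. *)
Inductive formula (X : Type) : Type :=
| fmem of X & X
| feq of X & X
| fneg of formula X
| fand of formula X & formula X
| fall of (X -> formula X).

Definition for_ X (f g : formula X) : formula X := fneg (fand (fneg f) (fneg g)).
Definition fimp X (f g : formula X) : formula X := fneg (fand f (fneg g)).
Definition fiff X (f g : formula X) : formula X := fand (fimp f g) (fimp g f).
Definition fex X (f : X -> formula X) : formula X :=
  fneg (fall (fun x => fneg (f x))).
Definition fall_in X (a : X) (f : X -> formula X) : formula X :=
  fall (fun x => fimp (fmem x a) (f x)).
Definition fex_in X (a : X) (f : X -> formula X) : formula X :=
  fex (fun x => fand (fmem x a) (f x)).
Definition fsub X (x y : X) : formula X := fall_in x (fun z => fmem z y).

Fixpoint bval d (B : ctbDistrLatticeType d) (f : formula (bname B)) : B :=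
  match f with
  | fmem x y => bmem x y
  | feq x y => beq x y
  | fneg g => ~` bval g
  | fand g h => bval g `&` bval h
  | fall g => bmeet (fun _ : bname B => True) (fun x => bval (g x))
  end.

Definition forces d (B : ctbDistrLatticeType d) (p : B)
    (f : formula (bname B)) : Prop :=
  p <= bval f.

Definition ultrafilter d (B : ctbDistrLatticeType d) (U : set B) : Prop :=
  [/\ ~ U \bot,
      forall a b : B, a <= b -> U a -> U b,
      forall a b : B, U a -> U b -> U (a `&` b)
    & forall a : B, U a \/ U (~` a)].

(* Truth (two-valued, in the sense of Tarski) in the generic extension of V
   determined by U, i.e. in the structure V^B / U of names modulo
   [[x = y]] \in U, with x \in y iff [[x \in y]] \in U.
   If B is atomless, V itself contains no V-generic filter, so a filter G with
   V_B[G] a genuine extension cannot be quantified over from within V. As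
   usual in that situation, generic extensions are taken to be the structures
   V^B / U, U any ultrafilter on B: the canonical name of the generic filter
   induces in V^B / U a filter that is generic over the class of the x with
   \/_v [[x = check v]] \in U, an elementary extension of V, and V^B / U is the
   resulting extension of that class; for a V-generic U it is isomorphic to
   V_B[U]. *)
Fixpoint holds_ext d (B : ctbDistrLatticeType d) (U : set B)
    (f : formula (bname B)) : Prop :=
  match f with
  | fmem x y => U (bmem x y)
  | feq x y => U (beq x y)
  | fneg g => ~ holds_ext U g
  | fand g h => holds_ext U g /\ holds_ext U h
  | fall g => forall x : bname B, holds_ext U (g x)
  end.

(* In the formulas below, ck interprets the sets of the ground model as
   parameters; it is instantiated with [check B]. *)

(* z = {x, y} and z = (x, y) *)
Definition is_upair X (z x y : X) : formula X :=
  fand (fand (fmem x z) (fmem y z))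
    (fall_in z (fun u => for_ (feq u x) (feq u y))).

Definition is_opair X (z x y : X) : formula X :=
  fex_in z (fun s => fex_in z (fun t =>
    fand (fand (is_upair s x x) (is_upair t x y)) (is_upair z s t))).

(* u = (m, k) for some k < 2 *)
Definition is_digit X (ck : vset -> X) (u m : X) : formula X :=
  fex_in (ck (vnat 2)) (fun k => is_opair u m k).

(* n = dom f, for f a 0-1 sequence *)
Definition is_dom X (ck : vset -> X) (f n : X) : formula X :=
  fand (fall_in n (fun m => fex_in f (fun u => is_digit ck u m)))
       (fall_in f (fun u => fex_in n (fun m => is_digit ck u m))).

(* g = f^k, that is, g = f \cup {(dom f, k)} *)
Definition is_snoc X (ck : vset -> X) (g f k : X) : formula X :=
  fex_in (ck vomega) (fun n => fand (is_dom ck f n)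
    (fex_in g (fun t => fand (is_opair t n k)
      (fand (fsub f g)
            (fall_in g (fun u => for_ (fmem u f) (feq u t))))))).

(* f = i restricted to n *)
Definition is_restr X (ck : vset -> X) (f i n : X) : formula X :=
  fand (fsub f i)
    (fall_in i (fun u =>
      fiff (fmem u f) (fex_in n (fun m => is_digit ck u m)))).

(* f \in g^i *)
Definition in_branch X (ck : vset -> X) (f i : X) : formula X :=
  fex_in (ck vomega) (fun n => is_restr ck f i n).

(* The subset {x : P x} of ^{<omega}2 is supported. An element of V is infinite in V iff it is in the
   extension, so the infinite subsets that belong to V are the elements of the
   canonical name of [vinfsets]. *)
Definition supported X (ck : vset -> X) (P : X -> formula X) : formula X :=
  fex_in (ck vinfsets) (fun A => fall_in A P).

Definition splits_tree X (ck : vset -> X) (r : X) : formula X :=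
  fall_in (ck vtree) (fun f =>
    fex_in (ck vtree) (fun f0 => fex_in (ck vtree) (fun f1 =>
      fand (fand (is_snoc ck f0 f (ck (vnat 0))) (is_snoc ck f1 f (ck (vnat 1))))
           (for_ (fand (fmem f0 r) (fneg (fmem f1 r)))
                 (fand (fneg (fmem f0 r)) (fmem f1 r)))))).

Definition unsupported_on_branches X (ck : vset -> X) (r : X) : formula X :=
  fall_in (ck vcantor) (fun i =>
    fneg (supported ck (fun f => fand (fmem f r) (in_branch ck f i)))).

(* r is a subset of ^{<omega}2 containing exactly one of f^0, f^1 for each f,
   and its intersection with g^i is unsupported for each i in (^omega 2)^V. *)
Definition selector X (ck : vset -> X) (r : X) : formula X :=
  fand (fsub r (ck vtree))
    (fand (splits_tree ck r) (unsupported_on_branches ck r)).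

(* Main.v *)
Require Import Defs.
From mathcomp Require Import all_boot all_order.
From mathcomp Require Import boolp classical_sets functions cardinality.
Set Implicit Arguments.
Unset Strict Implicit.
Unset Printing Implicit Defensive.

(** A strategy of White in which the moves depend only on Black's digits is a
    family w of elements of (0, p) indexed by the finite 0-1 sequences.  Since
    the earlier moves of White can be recomputed from the digits, every strategy
    has this form, so winning strategies and trees w as in (b) are the same
    thing ([strategy_to_tree], [tree_to_strategy]).

    A tree w in turn is the same thing as a name for a selector: w_f is the
    Boolean value of f^0 \in rho, and p \ w_f that of f^1 \in rho.  For an
    infinite set A of levels, the meet over n in A of w_(i|n)^(i(n)) is then the
    Boolean value of the inclusion in rho of the infinite ground-model subset
    {i|(n+1) : n in A} of the branch of i.  Hence w makes White win against
    every i iff p forces rho to have unsupported intersection with every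
    ground-model branch ([selector_to_tree], [tree_to_selector]).  To read this
    off the first-order formulas one needs that the bounded formulas occurring
    in them take the value 1 or 0, according to their truth, at canonical names
    ([decides_branch], [decides_snoc]), and that a quantifier bounded by a
    canonical name is a meet or join over the ground-model set
    ([bval_all_enum], [bval_ex_enum]).

    Some p > 0 forces the existence of a selector iff some structure V^B / U
    has one: by the theorem of Los ([los]) truth in V^B / U is membership of the
    Boolean value in U, and every nonzero element belongs to an ultrafilter
    ([ultrafilter_exists]).  The quantifier step of Los's theorem rests on the
    maximum principle ([maximum_principle]), which glues names along a maximal
    antichain.

    What remains is to replace the values 0 and p of a tree by values strictly
    between them ([white_tree_proper]).  A tree against which Black never wins
    forbids atoms below p, for Black could otherwise always answer with the side
    containing the atom.  So there is a sequence of disjoint nonzero elements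
    c_n below p, and a value 0 or p at level n is changed by c_n only.  Such a
    change affects each c_m at the single level m, and nothing outside the join
    of the c_m. *)

Import Order.Theory.
Local Open Scope order_scope.

(** * Sets of the ground model *)
Fixpoint veq (x : vset) : vset -> Prop :=
  let: VSet T u := x in fun y => let: VSet T' v := y in
  (forall i, exists j, veq (u i) (v j)) /\ (forall j, exists i, veq (u i) (v j)).

Lemma veq_refl x : veq x x.
Proof. by elim: x => I u IH /=; split=> i; exists i. Qed.

Lemma veq_sym x y : veq x y -> veq y x.
Proof.
by elim: x y => I u IH [J v] /= [uv vu]; split=> i;
  [have [j /IH] := vu i | have [j /IH] := uv i]; exists j.
Qed.

Lemma veq_trans x y z : veq x y -> veq y z -> veq x z.
Proof.
elim: x y z => I u IH [J v] [K w] /= [uv vu] [vw wv]; split=> [i|k].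
  by have [j /IH ij] := uv i; have [k /ij] := vw j; exists k.
by have [j jk] := wv k; have [i /IH ij] := vu j; exists i; exact: ij jk.
Qed.

(** Members are listed up to equality of type theory, so that formulas can be
    evaluated at the codes e k by rewriting. *)
Definition enumerates (w : vset) K (D : K -> Prop) (e : K -> vset) : Prop :=
  let: VSet T u := w in
  (forall i, exists2 k, D k & u i = e k) /\ (forall k, D k -> exists i, u i = e k).

Lemma enumerates_child I (u : I -> vset) : enumerates (VSet u) (fun=> True) u.
Proof. by split=> [i|i _]; exists i. Qed.

Lemma enumerates_vnat n : enumerates (vnat n) (fun m => (m < n)%N) vnat.
Proof.
elim: n => [|n]; first by split=> [[]|].
rewrite -[vnat n.+1]/(vsucc (vnat n)).
case E: (vnat n) => [T u] [IH1 IH2]; split=> [[i|]|k].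
- by have [k kn] := IH1 i; exists k => //; exact: ltnW.
- by exists n.
- rewrite ltnS leq_eqVlt => /orP[/eqP->|kn]; first by exists None; rewrite /= E.
  by have [i] := IH2 k kn; exists (Some i).
Qed.

Lemma enumerates_vseq s :
  enumerates (vseq s) (fun k => (k < size s)%N)
    (fun k => vopair (vnat k) (vnat (nth false s k))).
Proof.
split=> [k|k ks]; first by exists k.
by exists (Ordinal ks).
Qed.

Lemma enumerates_vsubset A : enumerates (vsubset A) A vseq.
Proof.
split=> [[s As]|s As]; first by exists s.
by exists (exist A s As).
Qed.

Lemma enumerates_vinfsets :
  enumerates vinfsets (fun A : set (seq bool) => infinite_set A) vsubset.
Proof.
split=> [[A iA]|A iA]; first by exists A.
by exists (exist (fun A : set (seq bool) => infinite_set A) A iA).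
Qed.

Definition vin x w : Prop := let: VSet T u := w in exists i, veq x (u i).

Lemma vin_enum w K (D : K -> Prop) e x :
  enumerates w D e -> vin x w <-> exists2 k, D k & veq x (e k).
Proof.
case: w => I u [ue eu]; split=> [[i xi]|[k /eu[i <-]]]; last by exists i.
by have [k Dk E] := ue i; exists k; rewrite // -E.
Qed.

Lemma vin_congr x x' y y' : veq x x' -> veq y y' -> vin x y -> vin x' y'.
Proof.
case: y y' => I u [J v] xx [uv _] [i xi]; have [j ij] := uv i; exists j.
exact: veq_trans (veq_sym xx) (veq_trans xi ij).
Qed.

Lemma veq_vupair x y x' y' :
  veq (vupair x y) (vupair x' y') <->
  (veq x x' /\ veq y y') \/ (veq x y' /\ veq y x').
Proof.
split=> [[l r]|H].
  have [[] lt] := l true; have [[] lf] := l false;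
  have [[] rt] := r true; have [[] rf] := r false; rewrite /= in lt lf rt rf;
  by [left|right].
case: H => [[xx yy]|[xy yx]]; split=> -[];
  by [exists true|exists false].
Qed.

Lemma veq_vopair x y x' y' :
  veq (vopair x y) (vopair x' y') <-> veq x x' /\ veq y y'.
Proof.
rewrite /vopair !veq_vupair; split=> [|[xx yy]]; last by left; split; left.
have last_eq : veq x x' -> veq x y' -> veq y x' -> veq x x' /\ veq y y'.
  by move=> xx xy yx; split=> //; apply: veq_trans yx (veq_trans (veq_sym xx) xy).
by case=> [[[[xx _]|[xx _]] [[_ yy]|[xy yx]]]|
  [[[xx xy]|[xy xx]] [[xx' yx]|[xx' yx]]]]; auto.
Qed.

Lemma veq_vnat m n : veq (vnat m) (vnat n) -> m = n.
Proof.
have lt k l : (k < l)%N -> ~ veq (vnat k) (vnat l).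
  elim/ltn_ind: l k => l IH k kl /veq_sym E.
  have : vin (vnat k) (vnat k).
    apply: vin_congr (veq_refl _) E _; rewrite (vin_enum _ (enumerates_vnat l)).
    by exists k => //; exact: veq_refl.
  by rewrite (vin_enum _ (enumerates_vnat k)) => -[j jk /veq_sym]; exact: IH.
by case: (ltngtP m n) => // [/lt|/lt + /veq_sym].
Qed.

Definition ventry k (b : bool) := vopair (vnat k) (vnat b).

Lemma veq_ventry k b l c : veq (ventry k b) (ventry l c) <-> k = l /\ b = c.
Proof.
rewrite veq_vopair; split=> [[/veq_vnat-> /veq_vnat]|[-> ->]].
  by case: b c => -[].
by split; exact: veq_refl.
Qed.

(** * Joins and meets in a complete Boolean algebra *)

Section Forcing.
Variables (d : Order.disp_t) (B : ctbDistrLatticeType d).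
Hypothesis Bcomplete : complete_boolean B.
Implicit Types (a b c e p : B) (x y z : bname B).

Lemma supremums_bjoin I (P : I -> Prop) (f : I -> B) :
  supremums (fun b : B => exists2 i : I, P i & b = f i) (bjoin P f).
Proof.
rewrite /bjoin /supremum; case: ifPn => [/eqP E|_].
  by rewrite E; split=> [b []//|b _]; exact: le0x.
by have [b bP] := Bcomplete (fun b : B => exists2 i : I, P i & b = f i); exact: xgetPex.
Qed.

Lemma bjoin_ub I (P : I -> Prop) (f : I -> B) i : P i -> f i <= bjoin P f.
Proof. by move=> Pi; apply: (supremums_bjoin P f).1; exists i. Qed.

Lemma bjoin_ge I (P : I -> Prop) (f : I -> B) i c :
  P i -> c <= f i -> c <= bjoin P f.
Proof. by move=> Pi /le_trans; apply; exact: bjoin_ub. Qed.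

Lemma bjoin_le I (P : I -> Prop) (f : I -> B) c :
  (forall i, P i -> f i <= c) -> bjoin P f <= c.
Proof. by move=> fc; apply: (supremums_bjoin P f).2 => _ [i Pi ->]; exact: fc. Qed.

Lemma infimums_bmeet I (P : I -> Prop) (f : I -> B) :
  infimums (fun b : B => exists2 i : I, P i & b = f i) (bmeet P f).
Proof.
rewrite /bmeet /infimum; set E := fun b : B => _.
case: ifPn => [/eqP ->|_].
  by split=> [b []//|b _]; exact: lex1.
have [b [ub lub]] := Bcomplete (lbound E); apply: xgetPex; exists b.
by split=> [c Ec|c Ec]; [apply: lub => c'; exact | exact: ub].
Qed.

Lemma bmeet_lb I (P : I -> Prop) (f : I -> B) i : P i -> bmeet P f <= f i.
Proof. by move=> Pi; apply: (infimums_bmeet P f).1; exists i. Qed.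

Lemma bmeet_lb_all I (f : I -> B) i : bmeet (fun=> True) f <= f i.
Proof. exact: bmeet_lb. Qed.

Lemma bmeet_ge I (P : I -> Prop) (f : I -> B) c :
  (forall i, P i -> c <= f i) -> c <= bmeet P f.
Proof. by move=> fc; apply: (infimums_bmeet P f).2 => _ [i Pi ->]; exact: fc. Qed.

Lemma eq_bjoin I (P : I -> Prop) (f h : I -> B) :
  (forall i, P i -> f i = h i) -> bjoin P f = bjoin P h.
Proof.
move=> E; apply/le_anti/andP; split; apply: bjoin_le => i Pi.
  by rewrite E //; exact: bjoin_ub.
by rewrite -E //; exact: bjoin_ub.
Qed.

Lemma eq_bmeet I (P : I -> Prop) (f h : I -> B) :
  (forall i, P i -> f i = h i) -> bmeet P f = bmeet P h.
Proof.
move=> E; apply/le_anti/andP; split; apply: bmeet_ge => i Pi.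
  by rewrite -E //; exact: bmeet_lb.
by rewrite E //; exact: bmeet_lb.
Qed.

Lemma le_bimp c a b : (c <= bimp a b) = (c `&` a <= b).
Proof. by rewrite /bimp -leBLR diffE complK. Qed.

Lemma le_compl c a : (c <= ~` a) = (c `&` a <= \bot).
Proof. by rewrite -disj_leC lex0. Qed.

(** Existential reasoning under an assumption c: by distributivity, it is enough
    to derive the conclusion from each disjunct together with c. *)
Lemma bjoin_elim I (P : I -> Prop) (f : I -> B) c g :
  c <= bjoin P f -> (forall i, P i -> c `&` f i <= g) -> c <= g.
Proof.
move=> cf fg; have fcg : bjoin P f <= bimp c g.
  by apply: bjoin_le => i Pi; rewrite le_bimp meetC; exact: fg.
by have := le_trans cf fcg; rewrite le_bimp meetxx.
Qed.

Lemma le_complP c a : (forall c', c' <= c -> c' <= a -> c' <= \bot) <-> c <= ~` a.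
Proof.
rewrite le_compl; split=> [H|H c' cc ca]; first by apply: H; [exact: leIl|exact: leIr].
by apply: le_trans H; rewrite lexI cc.
Qed.

(** Solves c <= b for c a meet of elements one of which is below b by a
    hypothesis, or syntactically. *)
Ltac below := solve [ assumption | exact: lexx | exact: lex1
  | rewrite lexI; apply/andP; split; below
  | apply: le_trans (leIl _ _) _; below
  | apply: le_trans (leIr _ _) _; below ].


(** * Equality and membership of names *)
Lemma beqE I J (u : I -> bname B) (b : I -> B) (v : J -> bname B) (c : J -> B) :
  beq (BName u b) (BName v c) =
  bmeet (fun _ : I => True) (fun j =>
    bimp (b j) (bjoin (fun _ : J => True) (fun k => c k `&` beq (u j) (v k))))
  `&`
  bmeet (fun _ : J => True) (fun k =>
    bimp (c k) (bjoin (fun _ : I => True) (fun j => b j `&` beq (u j) (v k)))).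
Proof. by []. Qed.

Lemma bmemE J x (v : J -> bname B) (c : J -> B) :
  bmem x (BName v c) = bjoin (fun _ : J => True) (fun k => c k `&` beq x (v k)).
Proof. by []. Qed.

Lemma beq_refl x : beq x x = \top.
Proof.
apply/eqP; rewrite -le1x; elim: x => I u IH b; rewrite beqE.
rewrite lexI; apply/andP; split; apply: bmeet_ge => j _;
by rewrite le_bimp meet1x; apply: (bjoin_ge (i := j)) => //;
  rewrite lexI lexx (le_trans _ (IH j)).
Qed.

Lemma beq_sym x y : beq x y = beq y x.
Proof.
elim: x y => I u IH b [J v c]; rewrite !beqE meetC.
by congr (_ `&` _); apply: eq_bmeet => k _; congr bimp;
  apply: eq_bjoin => j _; rewrite IH.
Qed.

Lemma beq_child I J (u : I -> bname B) (b : I -> B) (v : J -> bname B) (c : J -> B) j :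
  beq (BName u b) (BName v c) `&` b j <= bmem (u j) (BName v c).
Proof.
by rewrite bmemE -le_bimp beqE; apply: leIx2; apply/orP; left;
  exact: (bmeet_lb_all _ j).
Qed.

Lemma beq_ge I J (u : I -> bname B) (b : I -> B) (v : J -> bname B) (c : J -> B) e :
  (forall j, e `&` b j <= bmem (u j) (BName v c)) ->
  (forall k, e `&` c k <= bmem (v k) (BName u b)) ->
  e <= beq (BName u b) (BName v c).
Proof.
move=> uv vu; rewrite beqE lexI; apply/andP; split; apply: bmeet_ge => i _;
  rewrite le_bimp; first exact: uv.
apply: le_trans (vu i) _; rewrite bmemE; apply: bjoin_le => j _.
by apply: (bjoin_ge (i := j)); rewrite // (beq_sym (u j)).
Qed.

(** One inclusion of the transitivity of equality.  Only the members of the first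
    name enter the hypothesis, so that transitivity goes by induction on the
    first name, both inclusions being covered through symmetry. *)
Lemma beq_child_trans I J K (u : I -> bname B) (b : I -> B) (v : J -> bname B)
    (c : J -> B) (w : K -> bname B) (e : K -> B) j :
  (forall k l, beq (u j) (v k) `&` beq (v k) (w l) <= beq (u j) (w l)) ->
  beq (BName u b) (BName v c) `&` beq (BName v c) (BName w e) `&` b j
    <= bmem (u j) (BName w e).
Proof.
move=> tr; set F := _ `&` b j.
have H : F <= bmem (u j) (BName v c) by apply: le_trans (beq_child u b v c j); below.
apply: (bjoin_elim H) => k _.
have H' : F `&` (c k `&` beq (u j) (v k)) <= bmem (v k) (BName w e).
  by apply: le_trans (beq_child v c w e k); below.
apply: (bjoin_elim H') => l _; apply: (bjoin_ge (i := l)) => //.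
by rewrite lexI; apply/andP; split; [below | apply: le_trans (tr k l); below].
Qed.

Lemma beq_trans x y z : beq x y `&` beq y z <= beq x z.
Proof.
elim: x y z => I u IH b [J v c] [K w e]; apply: beq_ge => [j|l].
  by apply: beq_child_trans => k l; exact: IH.
rewrite [X in X `&` _]meetC (beq_sym (BName u b)) (beq_sym (BName v c)).
by apply: beq_child_trans => k j; rewrite meetC !(beq_sym (w l)) (beq_sym (v k)); exact: IH.
Qed.

Lemma bmem_congl x x' y : beq x x' `&` bmem x y <= bmem x' y.
Proof.
case: y => J v c; rewrite !bmemE; apply: (bjoin_elim (leIr _ _)) => k _.
apply: (bjoin_ge (i := k)) => //; rewrite lexI; apply/andP; split; first below.
by apply: le_trans (beq_trans x' x (v k)); rewrite (beq_sym x'); below.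
Qed.

Lemma bmem_congr x y y' : beq y y' `&` bmem x y <= bmem x y'.
Proof.
case: y y' => J v c [K w e]; rewrite [bmem x _]bmemE.
apply: (bjoin_elim (leIr _ _)) => k _.
apply: le_trans (bmem_congl (v k) x _); rewrite lexI; apply/andP; split.
  by rewrite (beq_sym (v k)); below.
by apply: le_trans (beq_child v c w e k); below.
Qed.

(** * Formulas as functions of names *)

(** The condition is quantified over all c <= e, in place of the equation of the
    meets with e, so that each connective is treated by its forcing clause. *)
Definition same e (f g : formula (bname B)) : Prop :=
  forall c, c <= e -> (c <= bval f <-> c <= bval g).

Lemma same_mem e x x' y y' :
  e <= beq x x' -> e <= beq y y' -> same e (fmem x y) (fmem x' y').
Proof.
move=> xx yy c ce; rewrite /=; split=> H.
  apply: le_trans (bmem_congr x' y y'); rewrite lexI (le_trans ce yy) /=.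
  by apply: le_trans (bmem_congl x x' y); rewrite lexI (le_trans ce xx).
apply: le_trans (bmem_congr x y' y); rewrite lexI beq_sym (le_trans ce yy) /=.
by apply: le_trans (bmem_congl x' x y'); rewrite lexI beq_sym (le_trans ce xx).
Qed.

Lemma same_eq e x x' y y' :
  e <= beq x x' -> e <= beq y y' -> same e (feq x y) (feq x' y').
Proof.
move=> xx yy c ce; have cx := le_trans ce xx; have cy := le_trans ce yy.
split=> /= H.
  apply: le_trans (beq_trans x' y y'); rewrite lexI cy andbT.
  by apply: le_trans (beq_trans x' x y); rewrite lexI beq_sym cx.
apply: le_trans (beq_trans x y' y); rewrite lexI (beq_sym y') cy andbT.
by apply: le_trans (beq_trans x x' y'); rewrite lexI cx.
Qed.

Lemma same_neg e f g : same e f g -> same e (fneg f) (fneg g).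
Proof.
move=> fg c ce /=; rewrite -!le_complP; split=> H c' cc' Hc'; apply: H => //;
  by apply/fg => //; exact: le_trans ce.
Qed.

Lemma same_and e f g f' g' :
  same e f f' -> same e g g' -> same e (fand f g) (fand f' g').
Proof. by move=> ff gg c ce /=; rewrite !lexI; split=> /andP[/ff-> // /gg->]. Qed.

Lemma same_all e (f g : bname B -> formula (bname B)) :
  (forall x, same e (f x) (g x)) -> same e (fall f) (fall g).
Proof.
move=> fg c ce /=; split=> H; apply: bmeet_ge => x _;
  by apply/fg => //; apply: le_trans H _; exact: (bmeet_lb_all _ x).
Qed.

Definition congruent (g : bname B -> formula (bname B)) : Prop :=
  forall x y, same (beq x y) (g x) (g y).

(** A [fall g] of the higher-order syntax may contain any function g from names
    to formulas.  Those that respect the Boolean-valued equality are the ones for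
    which names can be glued under the quantifier. *)
Fixpoint extensional (f : formula (bname B)) : Prop :=
  match f with
  | fmem _ _ | feq _ _ => True
  | fneg g => extensional g
  | fand g h => extensional g /\ extensional h
  | fall g => (forall x, extensional (g x)) /\ congruent g
  end.

Ltac unfold_formula :=
  cbv beta delta [selector unsupported_on_branches splits_tree supported
    in_branch is_restr is_snoc is_dom is_digit is_opair is_upair
    fsub fex_in fall_in fex fiff fimp for_].

(** Congruence is decided by the shape of the formula; the dispatch is on head
    symbols because unification would otherwise unfold the nested definitions at
    every attempt. *)
Ltac solve_same := lazymatch goal with
  | |- same _ (fmem _ _) (fmem _ _) => apply: same_mem; solve_same
  | |- same _ (feq _ _) (feq _ _) => apply: same_eq; solve_same
  | |- same _ (fneg _) (fneg _) => apply: same_neg; solve_same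
  | |- same _ (fand _ _) (fand _ _) => apply: same_and; solve_same
  | |- same _ (fall _) (fall _) => apply: same_all => ?; cbv beta; solve_same
  | |- is_true (_ <= beq ?x ?x) => by rewrite beq_refl ?lex1
  | |- is_true (_ <= beq _ _) => exact: lexx
  end.
Ltac solve_congruent := unfold_formula; move=> ? ?; cbv beta; solve_same.
Ltac solve_extensional := cbn [extensional]; lazymatch goal with
  | |- True => exact: I
  | |- _ /\ _ => split; solve_extensional
  | |- forall _, _ => move=> ?; solve_extensional
  | |- congruent _ => move=> ? ?; cbv beta; solve_same
  end.


Lemma extensional_selector (ck : vset -> bname B) r : extensional (selector ck r).
Proof. unfold_formula. solve_extensional. Qed.

(** * The maximum principle and Los's theorem *)
Definition bdom x : Type := let: BName T _ _ := x in T.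
Definition belt x : bdom x -> bname B :=
  match x with BName _ u _ => u end.
Definition bwt x : bdom x -> B :=
  match x with BName _ _ b => b end.

Lemma bnameE x : x = BName (@belt x) (@bwt x).
Proof. by case: x. Qed.

(** The gluing of names x m along an antichain M: every member of x m is put in
    with its weight cut down to m. *)
Definition mix (M : B -> Prop) (x : B -> bname B) : bname B :=
  BName (I := {m : {m : B | M m} & bdom (x (sval m))})
    (fun s => @belt (x (sval (tag s))) (tagged s))
    (fun s => sval (tag s) `&` @bwt (x (sval (tag s))) (tagged s)).

Lemma mix_eq (M : B -> Prop) (x : B -> bname B) m :
  (forall a b, M a -> M b -> a <> b -> a `&` b <= \bot) ->
  M m -> m <= beq (mix M x) (x m).
Proof.
move=> disj Mm; rewrite [X in beq _ X]bnameE; apply: beq_ge => [[[m' Mm'] j]|j] /=.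
  have [E|ne] := pselect (m = m').
    case: _ / E in Mm' j *.
    by apply: (bjoin_ge (i := j)) => //; rewrite beq_refl; below.
  by apply: le_trans (le0x _); apply: le_trans (disj _ _ Mm Mm' ne); below.
apply: (bjoin_ge (i := existT _ (exist M m Mm) j)) => //.
by rewrite beq_refl; below.
Qed.

(** Take a maximal antichain M of elements that lie below some value of g, and glue
    witnesses along M: the glued name has a value above every m in M.  A value
    of g not below that one would leave a nonzero element disjoint from M. *)
Lemma maximum_principle (g : bname B -> formula (bname B)) :
  congruent g -> exists z, forall x, bval (g x) <= bval (g z).
Proof.
move=> cg.
pose anti (M : set B) := (forall m, M m -> exists x, m <= bval (g x)) /\
  (forall a b, M a -> M b -> a <> b -> a `&` b <= \bot).
have [F antiF totF|M [[Mg disj] maxM]] := @Zorn_bigcup B anti.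
  split=> [m [X FX Xm]|a b [X FX Xa] [Y FY Yb]].
    by have [+ _] := antiF X FX; apply.
  by have [XY|YX] := totF X Y FX FY;
    [have [_] := antiF Y FY | have [_] := antiF X FX]; apply=> //; auto.
(* Witnesses are indexed by elements of B, so that the gluing is a name although
   the names themselves form a proper class. *)
have [x xM] : {x : B -> bname B & forall m, M m -> m <= bval (g (x m))}.
  apply: (@choice B (bname B) (fun m z => M m -> m <= bval (g z))) => m.
  have [Mm|nMm] := pselect (M m); last by exists (check B vomega).
  by have [z mz] := Mg m Mm; exists z.
exists (mix M x) => z; set h := bval (g (mix M x)).
have Mh m : M m -> m <= h.
  move=> Mm; apply/(cg _ (x m)); rewrite ?xM //.
  exact: mix_eq.
rewrite -diff_eq0; apply/eqP; apply: contrapT; set a := bval (g z) `\` h; move=> nz.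
have aM m : M m -> a `&` m <= \bot.
  move=> /Mh mh; rewrite -(diffIK (bval (g z)) h).
  by rewrite lexI leIl /= (le_trans (leIr _ _) mh).
apply: (maxM (M `|` [set a])%classic).
  split; first by move=> y; left.
  move=> /(_ a) H; have /aM : M a by apply: H; right.
  by rewrite meetxx lex0 => /eqP.
split=> [m [/Mg//|->]|b c [Mb|->] [Mc|->] ne //].
- by exists z; exact: leBx.
- exact: disj.
- by rewrite meetC; exact: aM.
- exact: aM.
Qed.

(** Only the quantifier needs an argument: if f x holds for every x, it holds for
    the x at which ~ f x attains its largest value, and there the value of f x is
    that of the universal formula. *)
Lemma los U f : ultrafilter U -> extensional f -> holds_ext U f <-> U (bval f).
Proof.
move=> [U0 Uup UI Uc]; elim: f => //= [f IH|f IHf g IHg|f IH].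
- move=> /IH{}IH; rewrite IH; split=> [nU|UN Uf].
    by have [] := Uc (bval f).
  by apply: U0; rewrite -(meetxC (bval f)); exact: UI.
- move=> [/IHf-> /IHg->]; split=> [[]|H]; first exact: UI.
  by split; apply: Uup H; [exact: leIl|exact: leIr].
- move=> [ef cf]; split=> [H|H x]; last first.
    by apply/IH => //; apply: Uup H; exact: (bmeet_lb_all _ x).
  have cNf : congruent (fun x => fneg (f x)) by move=> x y; apply: same_neg.
  have [z zmax] := maximum_principle cNf.
  apply: Uup (proj1 (IH z (ef z)) (H z)); apply: bmeet_ge => x _.
  by rewrite -leC; exact: zmax.
Qed.

(** A maximal member of the family of filters all of whose elements meet p.  The
    empty set is admitted in the family, so that the union of an empty chain
    belongs to it. *)
Lemma ultrafilter_exists p : \bot < p -> exists2 U : set B, ultrafilter U & U p.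
Proof.
move=> p0.
pose good (F : set B) := [/\ forall a b, a <= b -> F a -> F b,
  forall a b, F a -> F b -> F (a `&` b) & forall a, F a -> \bot < a `&` p].
have [C goodC totC|F [[Fup FI Fp] maxF]] := @Zorn_bigcup B good.
  split=> [a b ab [X CX Xa]|a b [X CX Xa] [Y CY Yb]|a [X CX Xa]].
  - by exists X => //; case: (goodC X CX) => + _ _; apply; eauto.
  - by have [XY|YX] := totC X Y CX CY; [exists Y|exists X] => //;
      [case: (goodC Y CY) => _ + _ | case: (goodC X CX) => _ + _]; apply; auto.
  - by case: (goodC X CX) => _ _; apply.
(* Maximality: if c is compatible with F and p, the filter generated by F and c is
   again in the family, so c belongs to F. *)
have Fin c : (forall v, F v \/ v = \top -> \bot < v `&` c `&` p) -> F c.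
  move=> Fc; pose G u := exists2 v, F v \/ v = \top & v `&` c <= u.
  have FG : (F `<=` G)%classic by move=> u Fu; exists u; [left|exact: leIl].
  apply: contrapT => nFc; apply: (maxF G).
    by split=> // /(_ c) GF; apply/nFc/GF; exists \top; [right|exact: leIr].
  split=> [a b ab [v Fv ya]|a b [v Fv ya] [w Fw zb]|a [v Fv ya]].
  - by exists v => //; exact: le_trans ab.
  - exists (v `&` w); last by rewrite lexI; apply/andP; split; 
      [apply: le_trans ya|apply: le_trans zb]; below.
    case: Fv Fw => [Fv|->] [Fw|->]; rewrite ?meet1x ?meetx1; auto.
  - by apply: lt_le_trans (Fc v Fv) _; rewrite leI2.
have Fp' v : F v \/ v = \top -> \bot < v `&` p by case=> [/Fp//|->]; rewrite meet1x.
have FT : F \top by apply: Fin => v; rewrite meetx1; exact: Fp'.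
exists F; last by apply: Fin => v; rewrite -meetA meetxx; exact: Fp'.
split=> //.
- by move=> /Fp; rewrite meet0x ltxx.
- move=> a; apply: contrapT => /not_orP[nFa nFc].
  have neg c : ~ F c -> exists2 v, F v & v `&` c `&` p = \bot.
    move=> nFc'; apply: contrapT => H; apply/nFc'/Fin => v Fv.
    rewrite lt0x; apply/eqP => E; apply: H; exists v => //.
    by case: Fv => [|->].
  have [v Fv ya] := neg _ nFa; have [w Fw zc] := neg _ nFc.
  have := Fp _ (FI _ _ Fv Fw); rewrite lt0x -lex0 => /negP; apply.
  rewrite -[X in X <= _](joinIB a) leUx; apply/andP; split.
    by rewrite -ya; below.
  by rewrite -zc diffE; below.
Qed.

(** * Formulas at canonical names *)
Lemma bimpE a b : bimp a b = ~` (a `&` ~` b).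
Proof. by rewrite complI complK. Qed.

Lemma le_fimp c f g : (c <= bval (fimp f g)) = (c `&` bval f <= bval g).
Proof. by rewrite /= -bimpE le_bimp. Qed.

Lemma compl_bjoin K (D : K -> Prop) (f : K -> B) :
  ~` bjoin D f = bmeet D (fun k => ~` f k).
Proof.
apply/le_anti/andP; split.
  by apply: bmeet_ge => k Dk; rewrite leC; exact: bjoin_ub.
rewrite lexC; apply: bjoin_le => k Dk; rewrite lexC.
exact: (bmeet_lb (fun k => ~` f k)).
Qed.

Lemma fall_in_ge c x g :
  (forall y, c `&` bmem y x <= bval (g y)) -> c <= bval (fall_in x g).
Proof.
move=> cg; rewrite /fall_in /=; apply: bmeet_ge => y _.
by rewrite -[X in _ <= X]/(bval (fimp (fmem y x) (g y))) le_fimp; exact: cg.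
Qed.

Lemma fall_in_le x g y : bval (fall_in x g) `&` bmem y x <= bval (g y).
Proof.
rewrite -[bmem y x]/(bval (fmem y x)) -le_fimp.
exact: (bmeet_lb_all (fun y => bval (fimp (fmem y x) (g y)))).
Qed.

Lemma bval_fall_in J (v : J -> bname B) (c : J -> B) g : congruent g ->
  bval (fall_in (BName v c) g) = bmeet (fun=> True) (fun j => bimp (c j) (bval (g (v j)))).
Proof.
move=> cg; apply/le_anti/andP; split.
  apply: bmeet_ge => j _; rewrite le_bimp.
  apply: le_trans (fall_in_le (BName v c) g (v j)); rewrite lexI leIl /=.
  by apply: (bjoin_ge (i := j)) => //; rewrite beq_refl; below.
apply: fall_in_ge => x; set F := bmeet _ _.
have cx : F `&` bmem x (BName v c) <= bmem x (BName v c) by exact: leIr.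
apply: (bjoin_elim cx) => j _; apply/(cg x (v j)); first by below.
have : F <= bimp (c j) (bval (g (v j))) by exact: (bmeet_lb_all _ j).
by rewrite le_bimp; apply: le_trans; below.
Qed.

Local Notation ck := (check B).

(** Quantification bounded by a canonical name is over the ground-model members of
    the set, however they are listed. *)
Lemma bval_all_enum w K (D : K -> Prop) en g : enumerates w D en -> congruent g ->
  bval (fall_in (ck w) g) = bmeet D (fun k => bval (g (ck (en k)))).
Proof.
case: w => J u [ue eu] cg; rewrite bval_fall_in //.
have top b : bimp \top b = b by rewrite /bimp compl1 join0x.
apply/le_anti/andP; split; apply: bmeet_ge.
  by move=> k /eu[j <-]; apply: le_trans (bmeet_lb_all _ j) _; rewrite top.
by move=> j _; have [k Dk ->] := ue j; rewrite top;
  exact: (bmeet_lb (fun k => bval (g (ck (en k))))).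
Qed.

Lemma bval_ex_enum w K (D : K -> Prop) en g : enumerates w D en -> congruent g ->
  bval (fex_in (ck w) g) = bjoin D (fun k => bval (g (ck (en k)))).
Proof.
move=> we cg; rewrite -[RHS]complK compl_bjoin.
have cng : congruent (fun x => fneg (g x)) by move=> x y; apply: same_neg.
rewrite -(bval_all_enum we cng) /=; congr (~` _); apply: eq_bmeet => x _.
by rewrite complK.
Qed.

Definition bt (P : Prop) : B := if `[<P>] then \top else \bot.

Lemma bt_true P : P -> bt P = \top.
Proof. by rewrite /bt; case: asboolP. Qed.

Lemma bt_false P : ~ P -> bt P = \bot.
Proof. by rewrite /bt; case: asboolP. Qed.

(** Absoluteness between the ground model, where f means P, and the Boolean-valued
    model. *)
Definition decides (f : formula (bname B)) (P : Prop) : Prop := bval f = bt P.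

Lemma decides_iff f P Q : decides f P -> (P <-> Q) -> decides f Q.
Proof. by move=> fP /propext <-. Qed.

Lemma decides_neg f P : decides f P -> decides (fneg f) (~ P).
Proof.
rewrite /decides /= => ->; have [p|np] := pselect P.
  by rewrite (bt_true p) bt_false ?compl1 // => /(_ p).
by rewrite (bt_false np) bt_true ?compl0.
Qed.

Lemma bt_and P Q : bt P `&` bt Q = bt (P /\ Q).
Proof.
have [p|np] := pselect P; last first.
  by rewrite (bt_false np) meet0x bt_false // => -[].
by rewrite (bt_true p) meet1x; congr bt; apply: propext; tauto.
Qed.

Lemma decides_and f g P Q : decides f P -> decides g Q -> decides (fand f g) (P /\ Q).
Proof. by rewrite /decides /= => -> ->; exact: bt_and. Qed.

Lemma decides_or f g P Q : decides f P -> decides g Q -> decides (for_ f g) (P \/ Q).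
Proof.
move=> fP gQ.
apply: decides_iff (decides_neg (decides_and (decides_neg fP) (decides_neg gQ))) _.
have := pselect P; have := pselect Q; tauto.
Qed.

Lemma decides_imp f g P Q : decides f P -> decides g Q -> decides (fimp f g) (P -> Q).
Proof.
move=> fP gQ; apply: decides_iff (decides_neg (decides_and fP (decides_neg gQ))) _.
have := pselect Q; tauto.
Qed.

Lemma decides_fiff f g P Q :
  decides f P -> decides g Q -> decides (fiff f g) (P <-> Q).
Proof. by move=> fP gQ; apply: decides_and; apply: decides_imp. Qed.

Lemma bmeet_bt K (D P : K -> Prop) :
  bmeet D (fun k => bt (P k)) = bt (forall k, D k -> P k).
Proof.
have [H|/existsNP[k /not_implyP[Dk nP]]] := pselect (forall k, D k -> P k).
  rewrite (bt_true H); apply/eqP; rewrite -le1x; apply: bmeet_ge => k /H Pk.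
  by rewrite (bt_true Pk).
rewrite [RHS]bt_false; last by move=> /(_ k Dk).
apply/eqP; rewrite -lex0 -(bt_false nP); exact: (bmeet_lb (fun k => bt (P k))).
Qed.

Lemma bjoin_bt K (D P : K -> Prop) :
  bjoin D (fun k => bt (P k)) = bt (exists2 k, D k & P k).
Proof.
have [[k Dk Pk]|H] := pselect (exists2 k, D k & P k).
  rewrite [RHS]bt_true; last by exists k.
  by apply/eqP; rewrite -le1x; apply: (bjoin_ge Dk); rewrite (bt_true Pk).
rewrite (bt_false H); apply/eqP; rewrite -lex0; apply: bjoin_le => k Dk.
by rewrite bt_false // => Pk; apply: H; exists k.
Qed.

Lemma decides_all w K (D : K -> Prop) en g P : enumerates w D en -> congruent g ->
  (forall k, D k -> decides (g (ck (en k))) (P k)) ->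
  decides (fall_in (ck w) g) (forall k, D k -> P k).
Proof.
move=> we cg gP; rewrite /decides (bval_all_enum we cg) -bmeet_bt.
exact: eq_bmeet.
Qed.

Lemma decides_ex w K (D : K -> Prop) en g P : enumerates w D en -> congruent g ->
  (forall k, D k -> decides (g (ck (en k))) (P k)) ->
  decides (fex_in (ck w) g) (exists2 k, D k & P k).
Proof.
move=> we cg gP; rewrite /decides (bval_ex_enum we cg) -bjoin_bt.
exact: eq_bjoin.
Qed.

Lemma decides_eq (x y : vset) : decides (feq (ck x) (ck y)) (veq x y).
Proof.
rewrite /decides /=; elim: x y => I u IH [J v]; rewrite [ck _]/= [ck (VSet v)]/= beqE.
have half K L (E : K -> L -> Prop) (F : K -> L -> B) : (forall k l, F k l = bt (E k l)) ->
    bmeet (fun=> True) (fun k => bimp \top (bjoin (fun=> True) (fun l => \top `&` F k l)))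
    = bt (forall k, exists l, E k l).
  move=> FE; have -> : (forall k, exists l, E k l) =
      (forall k, True -> exists2 l, True & E k l).
    by apply: propext; split=> H k; [move=> _|]; case: (H k) => // l; exists l.
  rewrite -bmeet_bt; apply: eq_bmeet => k _; rewrite /bimp compl1 join0x -bjoin_bt.
  by apply: eq_bjoin => l _; rewrite meet1x.
rewrite (half _ _ (fun i j => veq (u i) (v j))) => [|i j]; last exact: IH.
rewrite (half _ _ (fun j i => veq (u i) (v j))) => [|j i]; last exact: IH.
exact: bt_and.
Qed.

Lemma decides_mem (x w : vset) K (D : K -> Prop) en : enumerates w D en ->
  decides (fmem (ck x) (ck w)) (exists2 k, D k & veq x (en k)).
Proof.
case: w => J u [ue eu]; rewrite /decides /= -bjoin_bt.
apply/le_anti/andP; split; apply: bjoin_le.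
  move=> j _; rewrite meet1x; have [k Dk ->] := ue j; apply: (bjoin_ge Dk).
  by rewrite -decides_eq.
move=> k /eu[j <-]; apply: (bjoin_ge (i := j)) => //.
by rewrite meet1x -decides_eq.
Qed.

Lemma decides_vin (x w : vset) : decides (fmem (ck x) (ck w)) (vin x w).
Proof.
case: w => J u; apply: decides_iff (decides_mem _ (enumerates_child u)) _.
by split=> [[j _ xj]|[j xj]]; exists j.
Qed.

Lemma decides_upair (z x y : vset) :
  decides (is_upair (ck z) (ck x) (ck y)) (veq z (vupair x y)).
Proof.
case: z => J u; eapply decides_iff.
  apply: decides_and; first by apply: decides_and; exact: decides_vin.
  apply: (decides_all (enumerates_child u)) => [|j _].
    by solve_congruent.
  by apply: decides_or; exact: decides_eq.
split=> [[[[i xi] [j yj]] uxy]|[uxy xyu]].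
  split=> [k|[]]; [|by exists i; exact: veq_sym|by exists j; exact: veq_sym].
  by have [kx|ky] := uxy k I; [exists true | exists false].
split=> [|k _]; last by have [[] k'] := uxy k; [left|right].
by split; [have [i /veq_sym] := xyu true | have [i /veq_sym] := xyu false]; exists i.
Qed.

Lemma decides_opair (z x y : vset) :
  decides (is_opair (ck z) (ck x) (ck y)) (veq z (vopair x y)).
Proof.
case: z => J u; eapply decides_iff.
  apply: (decides_ex (enumerates_child u)) => [|i _].
    by solve_congruent.
  apply: (decides_ex (enumerates_child u)) => [|j _].
    by solve_congruent.
  by apply: decides_and; [apply: decides_and|]; exact: decides_upair.
split=> [[i _ [j _ [[ix jxy] zij]]]|zxy].
  by apply: veq_trans zij _; rewrite /vopair veq_vupair; left.
have [_ /[dup] /(_ true)[i ix] /(_ false)[j jxy]] := zxy.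
exists i => //; exists j => //; split=> //.
by apply: veq_trans zxy _; rewrite /vopair veq_vupair; left; split; exact: veq_sym.
Qed.

Lemma decides_digit l (b : bool) m :
  decides (is_digit ck (ck (ventry l b)) (ck (vnat m))) (l = m).
Proof.
eapply decides_iff.
  apply: (decides_ex (enumerates_vnat 2)) => [|k _].
    by solve_congruent.
  exact: decides_opair.
split=> [[k k2 /veq_vopair[/veq_vnat]]//|->].
by exists (nat_of_bool b); [case: (b) | exact: veq_refl].
Qed.

Lemma decides_dom s n : decides (is_dom ck (ck (vseq s)) (ck (vnat n))) (size s = n).
Proof.
eapply decides_iff.
  apply: decides_and.
    apply: (decides_all (enumerates_vnat n)) => [|m mn].
      by solve_congruent.
    apply: (decides_ex (enumerates_vseq s)) => [|k ks].
      by solve_congruent.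
    exact: decides_digit.
  apply: (decides_all (enumerates_vseq s)) => [|k ks].
    by solve_congruent.
  apply: (decides_ex (enumerates_vnat n)) => [|m mn].
    by solve_congruent.
  exact: decides_digit.
split=> [[ns sn]|<-]; last by split=> k ks; exists k.
apply/eqP; rewrite eqn_leq; apply/andP; split.
  by rewrite leqNgt; apply/negP => /sn[m mn E]; rewrite E ltnn in mn.
by rewrite leqNgt; apply/negP => /ns[m mn E]; rewrite E ltnn in mn.
Qed.

Lemma vin_vseq k (b : bool) s :
  vin (ventry k b) (vseq s) <-> (k < size s)%N /\ nth false s k = b.
Proof.
rewrite (vin_enum _ (enumerates_vseq s)); split=> [[l ls /veq_ventry[-> ->]]//|[ks <-]].
by exists k; [|exact: veq_refl].
Qed.

Lemma vin_vreal k (b : bool) (i : nat -> bool) : vin (ventry k b) (vreal i) <-> i k = b.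
Proof.
rewrite (vin_enum _ (enumerates_child _)); split=> [[l ls /veq_ventry[-> ->]]//|<-].
by exists k; [|exact: veq_refl].
Qed.

Lemma veq_vseq s t : veq (vseq s) (vseq t) -> s = t.
Proof.
have sub u v k : veq (vseq u) (vseq v) -> (k < size u)%N ->
    (k < size v)%N /\ nth false v k = nth false u k.
  move=> uv ku; apply/vin_vseq; apply: vin_congr (veq_refl _) uv _.
  exact/vin_vseq.
move=> st; have ts := veq_sym st; apply: (@eq_from_nth _ false) => [|k ks].
  apply/eqP; rewrite eqn_leq; apply/andP; split; rewrite leqNgt; apply/negP => lt.
    by have [] := sub _ _ _ st lt; rewrite ltnn.
  by have [] := sub _ _ _ ts lt; rewrite ltnn.
by have [_ ->] := sub _ _ _ st ks.
Qed.

(** The sequence t has an entry at position size s equal to b, agrees with s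
    before, and has no other entries. *)
Lemma decides_snoc t s (b : bool) :
  decides (is_snoc ck (ck (vseq t)) (ck (vseq s)) (ck (vnat b))) (t = rcons s b).
Proof.
eapply decides_iff.
  apply: (decides_ex (enumerates_child vnat)) => [|n _].
    by solve_congruent.
  apply: decides_and; first exact: decides_dom.
  apply: (decides_ex (enumerates_vseq t)) => [|l lt].
    by solve_congruent.
  apply: decides_and; first exact: decides_opair.
  apply: decides_and.
    apply: (decides_all (enumerates_vseq s)) => [|k ks].
      by solve_congruent.
    exact: decides_vin.
  apply: (decides_all (enumerates_vseq t)) => [|k kt].
    by solve_congruent.
  by apply: decides_or; [exact: decides_vin | exact: decides_eq].
split=> [[n _ [sn [l lt [/veq_ventry[ln tb] [st ts]]]]]|E].
  subst n l; have size_t : size t = (size s).+1.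
    apply/eqP; rewrite eqn_leq lt andbT leqNgt; apply/negP => st'.
    have [/vin_vseq[]|/veq_ventry[]] := ts _ st'; first by rewrite ltnNge leqnSn.
    by move=> /eqP; rewrite eqn_leq ltnn.
  apply: (@eq_from_nth _ false) => [|k kt]; first by rewrite size_rcons.
  rewrite nth_rcons; case: ltngtP => [ks|sk|->]//.
    by have /vin_vseq[] := st k ks.
  by move: kt; rewrite size_t ltnS leqNgt sk.
exists (size s) => //; split=> //.
exists (size s); first by rewrite E size_rcons.
split; first by apply/veq_ventry; rewrite E nth_rcons ltnn eqxx.
split=> k ks.
  by apply/vin_vseq; rewrite E size_rcons nth_rcons ks ltnW.
rewrite veq_ventry vin_vseq; move: ks; rewrite E size_rcons ltnS leq_eqVlt !nth_rcons ltnn eqxx.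
by case/orP => [/eqP->|ks]; [right; rewrite ltnn eqxx|left; rewrite ks].
Qed.

Lemma decides_restr s i n :
  decides (is_restr ck (ck (vseq s)) (ck (vreal i)) (ck (vnat n))) (s = mkseq i n).
Proof.
eapply decides_iff.
  apply: decides_and.
    apply: (decides_all (enumerates_vseq s)) => [|k ks].
      by solve_congruent.
    exact: decides_vin.
  apply: (decides_all (enumerates_child _)) => [|k _].
    by solve_congruent.
  apply: decides_fiff; first exact: decides_vin.
  apply: (decides_ex (enumerates_vnat n)) => [|m mn].
    by solve_congruent.
  exact: decides_digit.
split=> [[si isn]|->].
  have ltE k : (k < size s)%N = (k < n)%N.
    apply/idP/idP => [ks|kn].
      by have /(isn k I)[m mn ->] : vin (ventry k (i k)) (vseq s);
        [apply/vin_vseq; split=> //; have /vin_vreal := si k ks|].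
    by have /vin_vseq[] : vin (ventry k (i k)) (vseq s) by apply/(isn k I); exists k.
  have sn : size s = n.
    apply/eqP; rewrite eqn_leq; apply/andP; split; rewrite leqNgt.
      by rewrite ltE ltnn.
    by rewrite -ltE ltnn.
  apply: (@eq_from_nth _ false) => [|k ks]; first by rewrite size_mkseq.
  by rewrite nth_mkseq -?sn //; have /vin_vreal := si k ks.
rewrite size_mkseq; split=> [k kn|k _].
  by rewrite nth_mkseq //; apply/vin_vreal.
rewrite vin_vseq size_mkseq; split=> [[kn _]|[m mn ->]]; first by exists k.
by rewrite nth_mkseq.
Qed.

Lemma decides_branch s i :
  decides (in_branch ck (ck (vseq s)) (ck (vreal i))) (exists n, s = mkseq i n).
Proof.
eapply decides_iff.
  apply: (decides_ex (enumerates_child vnat)) => [|n _].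
    by solve_congruent.
  exact: decides_restr.
by split=> [[n _ E]|[n E]]; exists n.
Qed.

(** * Selectors and trees *)
Lemma inf_often_eq0 p q i : inf_often p q i = \bot <->
  forall A, infinite_set A -> bmeet (fun n => A n) (fun n => bpow p (q n) (i n)) <= \bot.
Proof.
split=> [H A Ainf|H]; last by apply/eqP; rewrite -lex0; apply: bjoin_le.
by rewrite -[X in _ <= X]H; apply: (bjoin_ge (i := A)).
Qed.

Lemma bval_and (f g : formula (bname B)) : bval (fand f g) = bval f `&` bval g.
Proof. by []. Qed.

Lemma bval_neg (f : formula (bname B)) : bval (fneg f) = ~` bval f.
Proof. by []. Qed.

Definition node_value (rho : bname B) (s : seq bool) : B := bmem (ck (vseq s)) rho.

Lemma bval_splits_tree rho : bval (splits_tree ck rho) =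
  bmeet (fun=> True) (fun s =>
    let m (b : bool) := node_value rho (rcons s b) in
    (m false `&` ~` m true) `|` (~` m false `&` m true)).
Proof.
rewrite (bval_all_enum (enumerates_child vseq)); last by solve_congruent.
apply: eq_bmeet => s _.
rewrite (bval_ex_enum (enumerates_child vseq)); last by solve_congruent.
set V := RHS; transitivity (bjoin (fun=> True) (fun s0 => bjoin (fun=> True) (fun s1 =>
    bt (s0 = rcons s false /\ s1 = rcons s true) `&` V))).
  apply: eq_bjoin => s0 _.
  rewrite (bval_ex_enum (enumerates_child vseq)); last by solve_congruent.
  apply: eq_bjoin => s1 _.
  rewrite bval_and (decides_and (decides_snoc s0 s false) (decides_snoc s1 s true)).
  have [E|nE] := pselect (s0 = rcons s false /\ s1 = rcons s true);
    last by rewrite (bt_false nE) !meet0x.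
  by rewrite (bt_true E) !meet1x; case: E => -> ->; rewrite /V /= complI !complK.
apply/le_anti/andP; split.
  by apply: bjoin_le => s0 _; apply: bjoin_le => s1 _; exact: leIr.
apply: (bjoin_ge (i := rcons s false)) => //; apply: (bjoin_ge (i := rcons s true)) => //.
by rewrite bt_true // meet1x.
Qed.

Lemma bval_unsupported rho : bval (unsupported_on_branches ck rho) =
  bmeet (fun=> True) (fun i => ~` bjoin (fun A : set (seq bool) => infinite_set A)
    (fun A => bmeet A (fun s => node_value rho s `&` bt (exists n, s = mkseq i n)))).
Proof.
rewrite (bval_all_enum (enumerates_child vreal)); last by solve_congruent.
apply: eq_bmeet => i _; rewrite bval_neg; congr (~` _); rewrite /supported.
rewrite (bval_ex_enum enumerates_vinfsets); last by solve_congruent.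
apply: eq_bjoin => A _.
rewrite (bval_all_enum (enumerates_vsubset A)); last by solve_congruent.
apply: eq_bmeet => s _.
by rewrite -decides_branch.
Qed.


(** Only the atoms f \in rho of the definition of a selector have values other than
    0 and 1 at canonical names. *)
Lemma forces_selector p rho : forces p (selector ck rho) <->
  [/\ p <= bval (fsub rho (ck vtree)),
      forall s, p <= (node_value rho (rcons s false) `&` ~` node_value rho (rcons s true))
        `|` (~` node_value rho (rcons s false) `&` node_value rho (rcons s true))
    & forall i (A : set (seq bool)), infinite_set A ->
        p `&` bmeet A (fun s => node_value rho s `&` bt (exists n, s = mkseq i n)) <= \bot].
Proof.
rewrite /forces /selector bval_and bval_and bval_splits_tree bval_unsupported !lexI.
split=> [/and3P[sub split unsup]|[sub split unsup]]; last first.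
  rewrite sub andTb; apply/andP; split; first by apply: bmeet_ge => s _; exact: split.
  apply: bmeet_ge => i _; rewrite compl_bjoin; apply: bmeet_ge => A Ainf.
  by rewrite le_compl; exact: unsup.
split=> // [s|i A Ainf].
  exact: le_trans split (bmeet_lb_all _ s).
rewrite -le_compl; apply: le_trans (le_trans unsup (bmeet_lb_all _ i)) _.
by rewrite leC; apply: (bjoin_ge (i := A)).
Qed.

Definition white_tree p (w : seq bool -> B) : Prop :=
  forall i : nat -> bool, inf_often p (fun n => w (mkseq i n)) i = \bot.

Lemma white_tree_infinite p w i (A : set nat) : white_tree p w -> infinite_set A ->
  bmeet A (fun n => bpow p (w (mkseq i n)) (i n)) <= \bot.
Proof. by move=> /(_ i) /inf_often_eq0; apply. Qed.

(** Below p, the value of f^1 \in rho is the complement of that of f^0 \in rho.  So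
    the meet over A is a lower bound for the value of the inclusion in rho of
    the infinite set of the initial segments i|(n+1), n in A. *)
Lemma selector_to_tree p rho : forces p (selector ck rho) ->
  exists w, (forall s, \bot <= w s <= p) /\ white_tree p w.
Proof.
move=> /forces_selector[_ split unsup].
exists (fun s => p `&` node_value rho (rcons s false)); split=> [s|i].
  by rewrite le0x leIl.
apply/inf_often_eq0 => A Ainf; set x := bmeet _ _.
have xp : x <= p.
  have [n An] := infinite_setN0 Ainf.
  apply: le_trans (bmeet_lb _ An) _; rewrite /bpow.
  by case: (i n); [exact: leBx | exact: leIl].
pose A' := [set mkseq i n.+1 | n in A]%classic.
have A'inf : infinite_set A'.
  move=> /(@finite_image _ _ _ (fun s => (size s).-1)) fin; apply: Ainf.
  apply: sub_finite_set fin => n An /=; exists (mkseq i n.+1); last by rewrite size_mkseq.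
  by exists n.
apply: le_trans (unsup i A' A'inf); rewrite lexI xp /=.
apply: bmeet_ge => _ [n An <-].
rewrite bt_true ?meetx1; last by exists n.+1.
apply: le_trans (bmeet_lb _ An) _; rewrite mkseqS /bpow.
case: (i n); last exact: leIr.
rewrite diffE complI meetUr -diffE diffxx join0x.
have := split (mkseq i n); set a := node_value _ _; set b := node_value _ _.
move=> pab; have : p `&` ~` a <= ((a `&` ~` b) `|` (~` a `&` b)) `&` ~` a.
  by rewrite lexI leIr (le_trans (leIl _ _) pab).
move=> /le_trans; apply; rewrite meetUl leUx; apply/andP; split; last by below.
by apply: le_trans (le0x _); rewrite -(meetxC a); below.
Qed.

Definition tree_name p (w : seq bool -> B) : bname B :=
  BName (fun sb : seq bool * bool => ck (vseq (rcons sb.1 sb.2)))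
    (fun sb => bpow p (w sb.1) sb.2).

Lemma node_value_tree_name p w t :
  node_value (tree_name p w) t =
  bjoin (fun sb : seq bool * bool => t = rcons sb.1 sb.2) (fun sb => bpow p (w sb.1) sb.2).
Proof.
rewrite /node_value bmemE; apply/le_anti/andP; split; apply: bjoin_le => sb.
  move=> _; have [E|nE] := pselect (t = rcons sb.1 sb.2).
    by apply: (bjoin_ge E); exact: leIl.
  rewrite -[beq _ _]/(bval (feq _ _)) decides_eq bt_false ?meetx0 ?le0x //.
  by move=> /veq_vseq.
by move=> E; apply: (bjoin_ge (i := sb)) => //; rewrite E beq_refl meetx1.
Qed.

(** Conversely, an infinite subset A of rho on the branch of i consists of segments
    i|(n+1), as the empty sequence has value 0, and the set of these n is
    infinite. *)
Lemma tree_to_selector p w : (forall s, w s <= p) -> white_tree p w ->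
  forces p (selector ck (tree_name p w)).
Proof.
move=> wp wtree.
have value_rcons s (b : bool) : node_value (tree_name p w) (rcons s b) = bpow p (w s) b.
  rewrite node_value_tree_name; apply/le_anti/andP; split.
    by apply: bjoin_le => -[s' b'] /= /rcons_inj[-> ->].
  exact: (bjoin_ge (i := (s, b))).
apply/forces_selector; split.
- rewrite /fsub bval_fall_in; last by solve_congruent.
  apply: bmeet_ge => -[s b] _; rewrite [bval _](decides_mem _ (enumerates_child vseq)).
  rewrite bt_true /bimp ?joinx1 ?lex1 //; exists (rcons s b) => //; exact: veq_refl.
- move=> s; rewrite !value_rcons /= !diffE.
  rewrite -[X in X <= _](joinIB (w s)) leUx; apply/andP; split.
    by apply: lexU2; rewrite complI complK lexI leIr /= lexU2 // leIr orbT.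
  apply: lexU2; rewrite diffE; apply/orP; right; below.
- move=> i A Ainf; set x := bmeet _ _.
  have [branch|/existsNP[s /not_implyP[As off]]] :=
      pselect (forall s, A s -> exists n, s = mkseq i n.+1); last first.
    apply: le_trans (leIr _ _) _; apply: le_trans (bmeet_lb _ As) _.
    have [[n E]|nE] := pselect (exists n, s = mkseq i n); last first.
      by rewrite (bt_false nE) meetx0.
    case: n E => [|n] E; last by case: off; exists n.
    rewrite E node_value_tree_name; apply: le_trans (leIl _ _) _.
    by apply: bjoin_le => -[[|? ?] ?].
  apply: le_trans (leIr _ _) _.
  apply: le_trans (white_tree_infinite i wtree (A := fun n => A (mkseq i n.+1)) _).
    apply: bmeet_ge => n An; apply: le_trans (bmeet_lb _ An) _.
    by rewrite mkseqS value_rcons leIl.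
  move=> /(@finite_image _ _ _ (fun n => mkseq i n.+1)) fin; apply: Ainf.
  apply: sub_finite_set fin => s As.
  by have [n E] := branch s As; exists n; rewrite /= -E.
Qed.

(** * Trees with values strictly between 0 and p *)
Lemma branch_of (b : seq bool -> bool) :
  exists i : nat -> bool, forall n, i n = b (mkseq i n).
Proof.
pose t := fix t n := if n is m.+1 then rcons (t m) (b (t m)) else [::].
exists (fun n => b (t n)) => n; congr b; elim: n => //= n {1}->.
by rewrite mkseqS.
Qed.

(** Against an atom a Black answers with the side that contains a, at every level;
    then a is below the meet over all levels. *)
Lemma white_tree_atomless p w a : white_tree p w -> \bot < a -> a <= p ->
  exists b, \bot < b < a.
Proof.
move=> wtree a0 ap; apply: contrapT => atom.
have [i iE] := branch_of (fun s => ~~ (a <= w s)).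
have : a <= \bot.
  apply: le_trans (white_tree_infinite i wtree (A := setT) infinite_nat).
  apply: bmeet_ge => n _; rewrite iE /bpow; case: ifPn; last by rewrite negbK.
  move=> naw; rewrite leBRL ap /=; apply: contrapT => /negP nz; apply: atom.
  exists (a `&` w (mkseq i n)); rewrite lt0x nz /= lt_neqAle leIl andbT.
  by rewrite -leEmeet.
by rewrite lex0 => /eqP E; rewrite E ltxx in a0.
Qed.

(** The successive differences of a strictly decreasing sequence. *)
Lemma disjoint_sequence p : \bot < p ->
  (forall a, \bot < a -> a <= p -> exists b, \bot < b < a) ->
  exists c : nat -> B, (forall n, \bot < c n < p) /\
    (forall m n, m <> n -> c m `&` c n <= \bot).
Proof.
move=> p0 atomless.
have [h hP] : {h : B -> B & forall a, \bot < a -> a <= p -> \bot < h a < a}.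
  apply: (@choice B B (fun a b => \bot < a -> a <= p -> \bot < b < a)) => a.
  have [[a0 ap]|na] := pselect (\bot < a /\ a <= p).
    by have [b] := atomless a a0 ap; exists b.
  by exists a => a0 ap; case: na.
pose v n := iter n h p.
have vP n : \bot < v n /\ v n <= p.
  elim: n => [|n [v0 vp]]; first by split.
  by have /andP[? /ltW hv] := hP _ v0 vp; split=> //; exact: le_trans vp.
have vlt n : v n.+1 < v n by have [v0 vp] := vP n; have /andP[] := hP _ v0 vp.
have vle m n : (m <= n)%N -> v n <= v m.
  by move=> /subnK <-; elim: (n - m)%N => // k IH; exact: le_trans (ltW (vlt _)) IH.
have lt_disj m n : (m < n)%N -> (v m `\` v m.+1) `&` (v n `\` v n.+1) <= \bot.
  move=> mn; rewrite -(meetxC (v m.+1)) !diffE.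
  by rewrite lexI; apply/andP; split; first apply: le_trans (vle _ _ mn); below.
exists (fun n => v n `\` v n.+1); split=> [n|m n].
  rewrite lt0x diff_eq0 (lt_geF (vlt n)) andTb lt_neqAle; apply/andP; split.
    apply/eqP => E; have : v n.+1 <= \bot.
      rewrite -(meetxC (v n.+1)) lexI lexx andTb.
      by apply: le_trans (vP n.+1).2 _; rewrite -E diffE leIr.
    by rewrite lex0 => /eqP E'; have [] := vP n.+1; rewrite E' ltxx.
  by apply: le_trans (leBx _ _) (vP n).2.
case: (ltngtP m n) => // mn _; first exact: lt_disj.
by rewrite meetC; exact: lt_disj.
Qed.

Lemma white_tree_proper p w : \bot < p -> (forall s, w s <= p) -> white_tree p w ->
  exists w', (forall s, \bot < w' s < p) /\ white_tree p w'.
Proof.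
move=> p0 wp wtree.
have [c [cP cdisj]] := disjoint_sequence p0 (fun a => white_tree_atomless (a := a) wtree).
pose w' s :=
  if w s == \bot then c (size s) else if w s == p then p `\` c (size s) else w s.
have w'P s : \bot < w' s < p.
  have /andP[c0 cp] := cP (size s); rewrite /w'; case: ifPn => [_|w0]; first exact: cP.
  case: ifPn => [_|wp']; last by rewrite lt0x w0 lt_neqAle wp' wp.
  rewrite lt0x diff_eq0 lt_geF //= lt_neqAle leBx andbT; apply/eqP => E.
  have : c (size s) <= \bot.
    rewrite -(meetxC (c (size s))) lexI lexx /=.
    by apply: le_trans (ltW cp) _; rewrite -{1}E diffE leIr.
  by rewrite lex0 => /eqP E'; rewrite E' ltxx in c0.
(* The exceptional values are chosen so that the change stays within c_n. *)
have w'w s k : bpow p (w' s) k <= bpow p (w s) k `|` c (size s).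
  rewrite /w'; case: ifPn => [/eqP->|_].
    by case: k; rewrite /= ?join0x // diffx0 lexU2 // leBx.
  case: ifPn => [/eqP->|_]; last exact: leUl.
  case: k => /=; last by rewrite lexU2 // leBx.
  by rewrite diffxx join0x diffxB diffxx join0x leIr.
exists w'; split=> // i; apply/inf_often_eq0 => A Ainf; set a := bmeet _ _.
have aw n : A n -> a <= bpow p (w (mkseq i n)) (i n) `|` c n.
  move=> An; apply: le_trans (bmeet_lb _ An) _.
  by apply: le_trans (w'w _ _) _; rewrite size_mkseq.
(* The sequence c being disjoint, below c_m the two trees differ at level m only,
   and A without m is still infinite. *)
have ac m : a `&` c m <= \bot.
  apply: le_trans (white_tree_infinite i wtree (infinite_setD Ainf (finite_set1 m))).
  apply: bmeet_ge => n [An nm].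
  have : a `&` c m <= (bpow p (w (mkseq i n)) (i n) `|` c n) `&` c m.
    by rewrite lexI leIr andbT; apply: le_trans (leIl _ _) (aw n An).
  rewrite meetUl => /le_trans; apply; rewrite leUx; apply/andP; split; first by below.
  by apply: le_trans (le0x _); apply: cdisj => E; apply: nm; rewrite E.
apply: le_trans (white_tree_infinite i wtree Ainf); apply: bmeet_ge => n An.
have : a <= (bpow p (w (mkseq i n)) (i n) `|` c n) `&` a by rewrite lexI aw //=.
rewrite meetUl => /le_trans; apply; rewrite leUx leIl /= meetC.
exact: le_trans (ac n) (le0x _).
Qed.

(** * Strategies as trees *)

(** The play in which White follows s and Black plays the digits of i. *)
Fixpoint history (s : white_strategy B) (i : nat -> bool) n : seq (B * bool) :=
  if n is m.+1 then rcons (history s i m) (reply s (history s i m), i m) else [::].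

Lemma eq_history s i j n :
  (forall k, (k < n)%N -> i k = j k) -> history s i n = history s j n.
Proof.
elim: n => //= n IH ij; rewrite IH ?ij // => k kn; apply: ij; exact: ltnW.
Qed.

Lemma follows_history s i : follows s (fun n => reply s (history s i n)) i.
Proof.
by move=> n; congr reply; elim: n => //= n IH; rewrite mkseqS -IH.
Qed.

(** The reply of s at a sequence f of digits: the history, including the moves of
    White, is recomputed from f. *)
Lemma strategy_to_tree s : winning_G3 s ->
  \bot < opening s /\
  exists w, (forall f, \bot < w f < opening s) /\ white_tree (opening s) w.
Proof.
move=> win; split; first by have [[]] := win _ _ (follows_history s (fun=> false)).
exists (fun f => reply s (history s (nth false f) (size f))); split=> [f|i].
  by have [[_]] := win _ _ (follows_history s (nth false f)).
have [_] := win _ _ (follows_history s i); rewrite /white_wins.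
congr (_ = _); congr inf_often; apply: funext => n; congr reply.
by rewrite size_mkseq; apply: eq_history => k kn; rewrite nth_mkseq.
Qed.

Lemma tree_to_strategy p w : \bot < p -> (forall f, \bot < w f < p) -> white_tree p w ->
  winning_G3 (WhiteStrategy p (fun h => w (map snd h))).
Proof.
move=> p0 wp wtree q i fol; have qE : q = fun n => w (mkseq i n).
  by apply: funext => n; rewrite fol /= /mkseq -map_comp.
by rewrite qE; split; [split | exact: wtree].
Qed.

End Forcing.

Theorem theorem6 (d : Order.disp_t) (B : ctbDistrLatticeType d)
    (Bcomplete : complete_boolean B) :
  [<-> (* (a) *)
       exists s : white_strategy B, winning_G3 s;
       (* (b) *)
       exists p : B, \bot < p /\
       exists w : seq bool -> B, (forall f, \bot < w f < p) /\
       forall i : nat -> bool, inf_often p (fun n => w (mkseq i n)) i = \bot;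
       (* (c) *)
       exists p : B, \bot < p /\
       exists w : seq bool -> B, (forall f, \bot <= w f <= p) /\
       forall i : nat -> bool, inf_often p (fun n => w (mkseq i n)) i = \bot;
       (* (d) *)
       exists p : B, \bot < p /\
       exists rho : bname B, forces p (selector (check B) rho);
       (* (e) *)
       exists U : set B, ultrafilter U /\
       holds_ext U (fex (fun R => selector (check B) R))].
Proof.
tfae.
- by move=> [s /strategy_to_tree[p0 [w wP]]]; exists (opening s); split=> //; exists w.
- move=> [p [p0 [w [wp wtree]]]]; exists p; split=> //; exists w; split=> // f.
  by have /andP[/ltW-> /ltW->] := wp f.
- move=> [p [p0 [w [wp wtree]]]]; exists p; split=> //; exists (tree_name p w).
  by apply: tree_to_selector wtree => // f; have /andP[] := wp f.
- move=> [p [p0 [rho prho]]]; have [U Uultra Up] := ultrafilter_exists p0.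
  exists U; split=> // none; apply: (none rho).
  apply/(los Bcomplete Uultra (extensional_selector Bcomplete _ _)).
  by case: Uultra => _ Uup _ _; exact: Uup prho Up.
- move=> [U [Uultra /existsNP[rho /contrapT]]].
  move/(los Bcomplete Uultra (extensional_selector Bcomplete _ _)) => Urho.
  set p := bval _ in Urho.
  have p0 : \bot < p by rewrite lt0x; apply/eqP => E; case: Uultra; rewrite -E.
  have [w [wp wtree]] := selector_to_tree Bcomplete (lexx p : forces p (selector _ rho)).
  have [|w' [w'p w'tree]] := white_tree_proper Bcomplete p0 _ wtree.
    by move=> s; have /andP[] := wp s.
  exists (WhiteStrategy p (fun h => w' (map snd h))).
  exact: tree_to_strategy.
Qed.
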